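(* Let $I=[0,1]$ or $I=[0,\infty)$. The space $Ces_\infty=Ces_\infty(I)$ contains an order isomorphically isometric copy of $\ell^\infty$.
   Context: $L^0(I)$ is the space of (a.e. equivalence classes of) real-valued Lebesgue measurable functions on $I$. $Ces_\infty(I)=\{f\in L^0(I): \|f\|_{Ces_\infty}=\sup_{0<x\in I}\frac1x\int_0^x|f(t)|\,dt<\infty\}$, ordered by the a.e. pointwise order. A Banach lattice $E$ contains an order isomorphically isometric copy of $\ell^\infty$ if there is a linear isometry of $\ell^\infty$ into $E$ that is an order (lattice) isomorphism onto its image. *)

(* Defs.v *)
From HB Require Import structures.
From mathcomp Require Import all_boot all_order all_algebra generic_quotient.
From mathcomp Require Import mathcomp_extra boolp classical_sets functions.
From mathcomp Require Import cardinality reals ereal topology normedtype.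
From mathcomp Require Import sequences measure measurable_realfun.
From mathcomp Require Import lebesgue_stieltjes_measure lebesgue_measure.
From mathcomp Require Import lebesgue_integral hoelder.

Set Implicit Arguments.
Unset Strict Implicit.
Unset Printing Implicit Defensive.
Import Order.TTheory GRing.Theory Num.Theory.
Import numFieldNormedType.Exports.
Local Open Scope classical_set_scope.
Local Open Scope ring_scope.
Local Open Scope quotient_scope.

(* The order is kept as plain fields: joining [Order.Lattice] with the normed
   modules in one HB structure would require changing the hierarchy below
   [Num.RealDomain]. *)
Record normedLattice (R : realType) := NormedLattice {
  nl_space :> normedModType R;
  nl_le : nl_space -> nl_space -> Prop;
  nl_join : nl_space -> nl_space -> nl_space;
  nl_meet : nl_space -> nl_space -> nl_space;
  nl_le_refl : forall x, nl_le x x;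
  nl_le_anti : forall x y, nl_le x y -> nl_le y x -> x = y;
  nl_le_trans : forall y x z, nl_le x y -> nl_le y z -> nl_le x z;
  nl_joinP : forall x y z, nl_le (nl_join x y) z <-> nl_le x z /\ nl_le y z;
  nl_meetP : forall x y z, nl_le z (nl_meet x y) <-> nl_le z x /\ nl_le z y;
  nl_leD : forall z x y, nl_le x y -> nl_le (x + z) (y + z);
  nl_leZ : forall (a : R) x y, 0 <= a -> nl_le x y -> nl_le (a *: x) (a *: y);
  nl_norm_le : forall x y,
    nl_le (nl_join x (- x)) (nl_join y (- y)) -> `|x| <= `|y|
}.

Definition contains_order_isometric_copy (R : realType)
    (F E : normedLattice R) : Prop :=
  exists T : {linear F -> E},
    [/\ forall x, `|T x| = `|x|,
        forall x y, nl_le (T x) (T y) <-> nl_le x y,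
        forall x y, T (nl_join x y) = nl_join (T x) (T y) &
        forall x y, T (nl_meet x y) = nl_meet (T x) (T y)].

Section linf.
Variable R : realType.

Definition linf_pred : {pred nat -> R} := mem [set u | bounded_fun u].

Lemma linf_predP u : reflect (exists M, forall n, `|u n| <= M) (u \in linf_pred).
Proof.
have PF : ProperFilter (globally [set: nat]).
  exact: globally_properfilter 0%N I.
apply: (iffP idP); rewrite /linf_pred inE /=.
  by move=> /ex_bound[M Mu]; exists M => n; exact: Mu.
by move=> [M Mu]; apply/ex_bound; exists M => n _; exact: Mu.
Qed.

Lemma linf_submod_closed : submod_closed linf_pred.
Proof.
split; first by apply/linf_predP; exists 0 => n; rewrite normr0.
move=> a u v /linf_predP[M Mu] /linf_predP[N Nv]; apply/linf_predP.
exists (`|a| * M + N) => n; rewrite (le_trans (ler_normD _ _))// lerD//.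
by rewrite normrM ler_wpM2l.
Qed.
HB.instance Definition _ :=
  GRing.isSubmodClosed.Build R (nat -> R) linf_pred linf_submod_closed.

Record linf := Linf { linf_val :> nat -> R; linf_valP : linf_val \in linf_pred }.
HB.instance Definition _ := [isSub for linf_val].
HB.instance Definition _ := [Choice of linf by <:].
HB.instance Definition _ := [SubChoice_isSubLmodule of linf by <:].

Definition linf_norm (u : linf) : R := sup (range (fun n => `|u n|)).

Lemma linf_norm_ub (u : linf) n : `|u n| <= linf_norm u.
Proof.
have [M Mu] := linf_predP _ (linf_valP u).
by apply: ub_le_sup; [exists M => _ [k _ <-]|exists n].
Qed.

Lemma linf_norm_le (u : linf) M : (forall n, `|u n| <= M) -> linf_norm u <= M.
Proof.
by move=> uM; apply: ge_sup; [exists `|u 0%N|, 0%N|move=> _ [n _ <-]].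
Qed.

Lemma linf_normD (u v : linf) : linf_norm (u + v) <= linf_norm u + linf_norm v.
Proof.
apply: linf_norm_le => n; rewrite (le_trans (ler_normD _ _))//.
by rewrite lerD ?linf_norm_ub.
Qed.

Lemma linf_normZ (a : R) (u : linf) : linf_norm (a *: u) = `|a| * linf_norm u.
Proof.
apply/eqP; rewrite eq_le; apply/andP; split.
  by apply: linf_norm_le => n; rewrite normrM ler_wpM2l ?linf_norm_ub.
have [->|a0] := eqVneq a 0.
  by rewrite normr0 mul0r (le_trans _ (linf_norm_ub _ 0%N)).
rewrite mulrC -ler_pdivlMr ?normr_gt0//; apply: linf_norm_le => n.
rewrite ler_pdivlMr ?normr_gt0// mulrC -normrM.
exact: (linf_norm_ub (a *: u) n).
Qed.

Lemma linf_norm0_eq0 (u : linf) : linf_norm u = 0 -> u = 0.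
Proof.
move=> u0; apply/val_inj/funext => n; apply/eqP.
by rewrite -normr_le0 -u0 linf_norm_ub.
Qed.

HB.instance Definition _ :=
  Lmodule_isNormed.Build R linf linf_normD linf_normZ linf_norm0_eq0.

Definition linf_le (u v : linf) : Prop := forall n, u n <= v n.

Lemma linf_join_subproof (u v : linf) : (u : nat -> R) \max v \in linf_pred.
Proof.
apply/linf_predP; exists (`|u| + `|v|) => n /=.
have un : `|u n| <= `|u| := linf_norm_ub u n.
have vn : `|v n| <= `|v| := linf_norm_ub v n.
by rewrite /Order.max; case: ifP => _; [apply: ler_wpDl|apply: ler_wpDr].
Qed.
Definition linf_join (u v : linf) : linf := Linf (linf_join_subproof u v).

Lemma linf_meet_subproof (u v : linf) : (u : nat -> R) \min v \in linf_pred.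
Proof.
apply/linf_predP; exists (`|u| + `|v|) => n /=.
have un : `|u n| <= `|u| := linf_norm_ub u n.
have vn : `|v n| <= `|v| := linf_norm_ub v n.
by rewrite /Order.min; case: ifP => _; [apply: ler_wpDr|apply: ler_wpDl].
Qed.
Definition linf_meet (u v : linf) : linf := Linf (linf_meet_subproof u v).

Lemma linf_le_refl u : linf_le u u.
Proof. by move=> n. Qed.

Lemma linf_le_anti u v : linf_le u v -> linf_le v u -> u = v.
Proof.
by move=> uv vu; apply/val_inj/funext => n; apply/le_anti; rewrite uv vu.
Qed.

Lemma linf_le_trans v u w : linf_le u v -> linf_le v w -> linf_le u w.
Proof. by move=> uv vw n; exact: le_trans (uv n) (vw n). Qed.

Lemma linf_joinP u v w :
  linf_le (linf_join u v) w <-> linf_le u w /\ linf_le v w.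
Proof.
split=> [h|[uw vw] n /=]; last by rewrite ge_max uw vw.
by split=> n; have := h n; rewrite /= ge_max => /andP[].
Qed.

Lemma linf_meetP u v w :
  linf_le w (linf_meet u v) <-> linf_le w u /\ linf_le w v.
Proof.
split=> [h|[uw vw] n /=]; last by rewrite le_min uw vw.
by split=> n; have := h n; rewrite /= le_min => /andP[].
Qed.

Lemma linf_leD w u v : linf_le u v -> linf_le (u + w) (v + w).
Proof. by move=> uv n; apply: lerD. Qed.

Lemma linf_leZ (a : R) u v : 0 <= a -> linf_le u v -> linf_le (a *: u) (a *: v).
Proof. by move=> a0 uv n; apply: ler_wpM2l. Qed.

Lemma linf_norm_mono u v :
  linf_le (linf_join u (- u)) (linf_join v (- v)) -> `|u| <= `|v|.
Proof.
move=> uv; apply: linf_norm_le => n; apply: le_trans (linf_norm_ub v n).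
by rewrite -!maxrN; exact: uv.
Qed.

Definition linf_lattice : normedLattice R :=
  @NormedLattice R linf linf_le linf_join linf_meet linf_le_refl linf_le_anti linf_le_trans
    linf_joinP linf_meetP linf_leD linf_leZ linf_norm_mono.

End linf.

Section L0.
Context d (T : measurableType d) (R : realType).
Variable mu : {measure set T -> \bar R}.

Definition L0 : Type := {mfun_ mu, T >-> R}.
HB.instance Definition _ := Choice.on L0.
HB.instance Definition _ := EqQuotient.on L0.
Definition L0_fun (f : L0) : T -> R := @aqEqMfun_to_fun _ _ _ _ _ mu f.
Coercion L0_fun : L0 >-> Funclass.

Definition L0_of (f : T -> R) (mf : measurable_fun setT f) : L0 :=
  \pi_{mfun_ mu, T >-> R} (mfun_Sub (mem_set mf : f \in mfun)).

Lemma L0_meas (f : L0) : measurable_fun setT f.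
Proof. exact: measurable_funPT. Qed.

Lemma L0_eq (f g : L0) : (\forall x \ae mu, f x = g x) -> f = g.
Proof.
move=> fg; apply/eqP; rewrite -[f]reprK -[g]reprK; apply/eqP.
by apply/eqmodP/asboolP; apply: filterS fg => x + _.
Qed.

Lemma L0_ofE (f : T -> R) (mf : measurable_fun setT f) :
  \forall x \ae mu, L0_of mf x = f x.
Proof.
have /eqmodP/asboolP := reprK (L0_of mf).
by apply: filterS => x; apply.
Qed.

Definition L0_add (f g : L0) : L0 :=
  L0_of (measurable_funD (L0_meas f) (L0_meas g)).
Definition L0_opp (f : L0) : L0 := L0_of (measurable_funN (L0_meas f)).
Definition L0_zero : L0 := L0_of (measurable_cst (0 : R)).
Definition L0_scale (a : R) (f : L0) : L0 :=
  L0_of (measurable_funM (measurable_cst a) (L0_meas f)).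
Definition L0_join (f g : L0) : L0 :=
  L0_of (measurable_maxr (L0_meas f) (L0_meas g)).
Definition L0_meet (f g : L0) : L0 :=
  L0_of (measurable_minr (L0_meas f) (L0_meas g)).
Definition L0_le (f g : L0) : Prop := \forall x \ae mu, f x <= g x.

Let addE f g : \forall x \ae mu, L0_add f g x = f x + g x.
Proof. exact: L0_ofE. Qed.
Let oppE f : \forall x \ae mu, L0_opp f x = - f x.
Proof. exact: L0_ofE. Qed.
Let zeroE : \forall x \ae mu, L0_zero x = 0.
Proof. exact: L0_ofE. Qed.
Let scaleE a f : \forall x \ae mu, L0_scale a f x = a * f x.
Proof. exact: L0_ofE. Qed.

Let addA : associative L0_add.
Proof.
move=> f g h; apply: L0_eq; near=> x.
rewrite (near (addE f (L0_add g h)) x)// (near (addE g h) x)//.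
by rewrite (near (addE (L0_add f g) h) x)// (near (addE f g) x)// addrA.
Unshelve. all: by end_near. Qed.

Let addC : commutative L0_add.
Proof.
move=> f g; apply: L0_eq; near=> x.
by rewrite (near (addE f g) x)// (near (addE g f) x)// addrC.
Unshelve. all: by end_near. Qed.

Let add0 : left_id L0_zero L0_add.
Proof.
move=> f; apply: L0_eq; near=> x.
by rewrite (near (addE L0_zero f) x)// (near zeroE x)// add0r.
Unshelve. all: by end_near. Qed.

Let addN : left_inverse L0_zero L0_opp L0_add.
Proof.
move=> f; apply: L0_eq; near=> x.
rewrite (near (addE (L0_opp f) f) x)// (near zeroE x)//.
by rewrite (near (oppE f) x)// addNr.
Unshelve. all: by end_near. Qed.

HB.instance Definition _ := GRing.isZmodule.Build L0 addA addC add0 addN.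

Let scaleA a b f : L0_scale a (L0_scale b f) = L0_scale (a * b) f.
Proof.
apply: L0_eq; near=> x.
rewrite (near (scaleE a (L0_scale b f)) x)// (near (scaleE b f) x)//.
by rewrite (near (scaleE (a * b) f) x)// mulrA.
Unshelve. all: by end_near. Qed.

Let scale1 : left_id 1 L0_scale.
Proof.
move=> f; apply: L0_eq; near=> x.
by rewrite (near (scaleE 1 f) x)// mul1r.
Unshelve. all: by end_near. Qed.

Let scaleDr : right_distributive L0_scale +%R.
Proof.
move=> a f g; apply: L0_eq; near=> x.
rewrite (near (scaleE a (f + g)) x)// (near (addE f g) x)// mulrDr.
rewrite (near (addE (L0_scale a f) (L0_scale a g)) x)//.
by rewrite (near (scaleE a f) x)// (near (scaleE a g) x)//.
Unshelve. all: by end_near. Qed.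

Let scaleDl f : {morph L0_scale^~ f : a b / a + b}.
Proof.
move=> a b; apply: L0_eq; near=> x.
rewrite (near (scaleE (a + b) f) x)// mulrDl.
rewrite (near (addE (L0_scale a f) (L0_scale b f)) x)//.
by rewrite (near (scaleE a f) x)// (near (scaleE b f) x)//.
Unshelve. all: by end_near. Qed.

HB.instance Definition _ :=
  GRing.Zmodule_isLmodule.Build R L0 scaleA scale1 scaleDr scaleDl.

Lemma L0_addE (f g : L0) : \forall x \ae mu, (f + g : L0) x = f x + g x.
Proof. exact: addE. Qed.
Lemma L0_oppE (f : L0) : \forall x \ae mu, (- f : L0) x = - f x.
Proof. exact: oppE. Qed.
Lemma L0_zeroE : \forall x \ae mu, (0 : L0) x = 0.
Proof. exact: zeroE. Qed.
Lemma L0_scaleE (a : R) (f : L0) : \forall x \ae mu, (a *: f : L0) x = a * f x.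
Proof. exact: scaleE. Qed.
Lemma L0_joinE (f g : L0) :
  \forall x \ae mu, L0_join f g x = Num.max (f x) (g x).
Proof. exact: L0_ofE. Qed.
Lemma L0_meetE (f g : L0) :
  \forall x \ae mu, L0_meet f g x = Num.min (f x) (g x).
Proof. exact: L0_ofE. Qed.

Lemma L0_le_refl f : L0_le f f.
Proof. exact: aeW. Qed.

Lemma L0_le_anti f g : L0_le f g -> L0_le g f -> f = g.
Proof.
move=> fg gf; apply: L0_eq; apply: filterS2 fg gf => x fg gf.
by apply/le_anti; rewrite fg gf.
Qed.

Lemma L0_le_trans g f h : L0_le f g -> L0_le g h -> L0_le f h.
Proof. by apply: filterS2 => x; exact: le_trans. Qed.

Lemma L0_joinP f g h : L0_le (L0_join f g) h <-> L0_le f h /\ L0_le g h.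
Proof.
split=> [H|[fh gh]].
  by split; apply: filterS2 H (L0_joinE f g) => x /[swap] ->;
    rewrite ge_max => /andP[].
near=> x; rewrite (near (L0_joinE f g) x)// ge_max.
by rewrite (near fh x)// (near gh x).
Unshelve. all: by end_near. Qed.

Lemma L0_meetP f g h : L0_le h (L0_meet f g) <-> L0_le h f /\ L0_le h g.
Proof.
split=> [H|[fh gh]].
  by split; apply: filterS2 H (L0_meetE f g) => x /[swap] ->;
    rewrite le_min => /andP[].
near=> x; rewrite (near (L0_meetE f g) x)// le_min.
by rewrite (near fh x)// (near gh x).
Unshelve. all: by end_near. Qed.

Lemma L0_leD h f g : L0_le f g -> L0_le (f + h) (g + h).
Proof.
move=> fg; near=> x.
rewrite (near (L0_addE f h) x)// (near (L0_addE g h) x)// lerD2r.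
by near: x.
Unshelve. all: by end_near. Qed.

Lemma L0_leZ (a : R) f g : 0 <= a -> L0_le f g -> L0_le (a *: f) (a *: g).
Proof.
move=> a0 fg; near=> x.
rewrite (near (L0_scaleE a f) x)// (near (L0_scaleE a g) x)// ler_wpM2l//.
by near: x.
Unshelve. all: by end_near. Qed.

Lemma L0_absE f :
  \forall x \ae mu, L0_join f (- f) x = `|f x|.
Proof.
near=> x; rewrite (near (L0_joinE f (- f)) x)// (near (L0_oppE f) x)//.
by rewrite maxrN.
Unshelve. all: by end_near. Qed.

End L0.

(* [lebesgueType R] carries the Lebesgue (Caratheodory) sigma-algebra, not the
   Borel one. *)
Definition lebesgueType (R : realType) := caratheodory_type (@wlength R idfun)^*%mu.

Section lebesgue_on.
Context {R : realType}.

Lemma lebesgue_measurable_itv (I : interval R) :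
  measurable ([set` I] : set (lebesgueType R)).
Proof. by apply: sub_caratheodory; exact: measurable_itv. Qed.

(* A class of functions on [I] is a class of functions on [R] modulo equality
   almost everywhere for the Lebesgue measure restricted to [I]: the complement
   of [I] is negligible, see [lebesgue_on_ae]. *)
Definition lebesgue_on (I : interval R) :
    {measure set (lebesgueType R) -> \bar R} :=
  mrestr (@completed_lebesgue_measure R) (lebesgue_measurable_itv I).

Lemma lebesgue_on_ae (I : interval R) : \forall x \ae lebesgue_on I, x \in I.
Proof.
exists (~` [set` I]); split => //.
- exact/measurableC/lebesgue_measurable_itv.
- by rewrite /lebesgue_on /= /mrestr setICl measure0.
Qed.

End lebesgue_on.

Section Cesaro.
Variables (R : realType) (I : interval R).
Local Notation mu := (lebesgue_on I).
Local Open Scope ereal_scope.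

Definition cesaro_norm (f : L0 mu) : \bar R :=
  ereal_sup [set x^-1%:E * \int[mu]_(t in `[0%R, x]) `|f t|%:E
            | x in [set x | x \in I /\ (0 < x)%R]].


Let F (f : L0 mu) (x : R) := \int[mu]_(t in `[0%R, x]) `|f t|%:E.

Let mitv (x : R) : measurable (`[0%R, x] : set (lebesgueType R)).
Proof. exact: lebesgue_measurable_itv. Qed.

Let mabs (D : set (lebesgueType R)) (f : L0 mu) :
  measurable_fun D (fun t => `|f t|%:E).
Proof.
apply: measurable_funTS; apply/measurable_EFinP.
by apply: measurableT_comp => //; exact: L0_meas.
Qed.

Let F_ge0 f x : 0 <= F f x.
Proof. by apply: integral_ge0 => t _; rewrite lee_fin. Qed.

Lemma cesaro_norm_le (f g : L0 mu) : (\forall t \ae mu, `|f t| <= `|g t|)%R ->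
  cesaro_norm f <= cesaro_norm g.
Proof.
move=> fg; apply: ge_ereal_sup => _ [x /= [xI x0] <-].
apply: le_trans (ereal_sup_ubound _); last by exists x.
rewrite lee_pmul2l// ?lte_fin ?invr_gt0//.
apply: ae_ge0_le_integral => //.
by apply: filterS fg => t h _; rewrite lee_fin.
Qed.

Lemma cesaro_normD (f g : L0 mu) :
  cesaro_norm (f + g)%R <= cesaro_norm f + cesaro_norm g.
Proof.
apply: ge_ereal_sup => _ [x /= [xI x0] <-].
apply: (@le_trans _ _ (x^-1%:E * F f x + x^-1%:E * F g x)); last first.
  by apply: leeD; apply: ereal_sup_ubound; exists x.
rewrite -ge0_muleDr// lee_pmul2l// ?lte_fin ?invr_gt0//.
rewrite /F -ge0_integralD//.
apply: ae_ge0_le_integral => //.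
- by move=> t _; rewrite -EFinD lee_fin addr_ge0.
- exact: emeasurable_funD.
- apply: filterS (L0_addE f g) => t -> _.
  by rewrite -EFinD lee_fin ler_normD.
Qed.

Lemma cesaro_normZ_le (a : R) (f : L0 mu) :
  cesaro_norm (a *: f)%R <= `|a|%:E * cesaro_norm f.
Proof.
apply: ge_ereal_sup => _ [x /= [xI x0] <-].
apply: (@le_trans _ _ (`|a|%:E * (x^-1%:E * F f x))); last first.
  by rewrite lee_wpmul2l// ?lee_fin//; apply: ereal_sup_ubound; exists x.
rewrite muleCA lee_pmul2l// ?lte_fin ?invr_gt0//.
rewrite /F -ge0_integralZl_EFin//.
apply: ae_ge0_le_integral => //.
- by apply: measurable_funeM => //; exact: mabs.
- by apply: filterS (L0_scaleE a f) => t -> _; rewrite normrM.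
Qed.

Lemma cesaro_normZ (a : R) (f : L0 mu) : a != 0%R ->
  cesaro_norm (a *: f)%R = `|a|%:E * cesaro_norm f.
Proof.
move=> a0; apply/eqP; rewrite eq_le cesaro_normZ_le/=.
have a1 : (0 < `|a|)%R by rewrite normr_gt0.
rewrite -lee_pdivlMl//; rewrite -[in leLHS](scalerK a0 f).
by rewrite (le_trans (cesaro_normZ_le _ _))// normfV.
Qed.

Definition cesaro_pred : {pred L0 mu} := mem [set f | cesaro_norm f < +oo].

Lemma cesaro_predE f : (f \in cesaro_pred) = (cesaro_norm f < +oo).
Proof. by apply/idP/idP; rewrite /cesaro_pred inE. Qed.

Lemma cesaro_submod_closed : submod_closed cesaro_pred.
Proof.
have Z0 : 0%R \in cesaro_pred.
  rewrite cesaro_predE; apply: (@le_lt_trans _ _ 0) => //.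
  apply: ge_ereal_sup => _ [x /= [xI x0] <-].
  rewrite (ae_eq_integral (cst 0)) ?integral0 ?mule0//.
  by apply: filterS (L0_zeroE mu) => t -> _; rewrite normr0.
split => // a f g; rewrite !cesaro_predE => f1 g1.
apply: le_lt_trans (cesaro_normD _ _) _; apply: lte_add_pinfty => //.
have [->|a0] := eqVneq a 0%R; first by rewrite scale0r -cesaro_predE.
by rewrite cesaro_normZ// lte_mul_pinfty.
Qed.
HB.instance Definition _ :=
  GRing.isSubmodClosed.Build R (L0 mu) cesaro_pred cesaro_submod_closed.

Lemma cesaro_join_closed f g :
  f \in cesaro_pred -> g \in cesaro_pred -> L0_join f g \in cesaro_pred.
Proof.
rewrite !cesaro_predE => f1 g1.
have h1 : cesaro_norm (L0_join f (- f) + L0_join g (- g))%R < +oo.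
  apply: le_lt_trans (cesaro_normD _ _) _; apply: lte_add_pinfty.
  - apply: le_lt_trans f1; apply: cesaro_norm_le.
    by apply: filterS (L0_absE f) => t ->; rewrite normr_id.
  - apply: le_lt_trans g1; apply: cesaro_norm_le.
    by apply: filterS (L0_absE g) => t ->; rewrite normr_id.
apply: le_lt_trans h1; apply: cesaro_norm_le; near=> t.
rewrite (near (L0_joinE f g) t)//.
rewrite (near (L0_addE (L0_join f (- f)%R) (L0_join g (- g)%R)) t)//.
rewrite (near (L0_absE f) t)// (near (L0_absE g) t)//.
rewrite [leRHS]ger0_norm ?addr_ge0// /Num.max.
by case: ifP => _; [apply: ler_wpDl|apply: ler_wpDr].
Unshelve. all: by end_near. Qed.

Lemma cesaro_meet_closed f g :
  f \in cesaro_pred -> g \in cesaro_pred -> L0_meet f g \in cesaro_pred.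
Proof.
rewrite -(rpredN _ f) -(rpredN _ g) => f1 g1.
have := cesaro_join_closed f1 g1; rewrite !cesaro_predE; apply: le_lt_trans.
apply: cesaro_norm_le; near=> t.
rewrite (near (L0_joinE (- f)%R (- g)%R) t)// (near (L0_meetE f g) t)//.
by rewrite (near (L0_oppE f) t)// (near (L0_oppE g) t)// -oppr_min normrN.
Unshelve. all: by end_near. Qed.

End Cesaro.

Definition cesaro_domain (R : realType) (I : interval R) : Prop :=
  I = `[0, 1] \/ I = `[0, +oo[.

Record Ces (R : realType) (I : interval R) (hI : cesaro_domain I) :=
  MkCes { ces_val :> L0 (lebesgue_on I); ces_valP : ces_val \in @cesaro_pred R I }.

Section Ces.
Variables (R : realType) (I : interval R) (hI : cesaro_domain I).
Local Notation mu := (lebesgue_on I).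
Local Notation Ces := (Ces hI).
HB.instance Definition _ := [isSub for @ces_val R I hI].
HB.instance Definition _ := [Choice of Ces by <:].
HB.instance Definition _ := [SubChoice_isSubLmodule of Ces by <:].
Implicit Types f g h : Ces.

Definition Ces_norm f : R := fine (cesaro_norm f).

Lemma domain1 : (1 : R) \in I.
Proof. by case: hI => ->; rewrite in_itv /= ?ler01 ?lexx. Qed.

Lemma Ces_normE f : (Ces_norm f)%:E = cesaro_norm f.
Proof.
rewrite fineK// ge0_fin_numE; first by rewrite -cesaro_predE ces_valP.
apply: le_trans (ereal_sup_ubound _); last first.
  by exists 1; [split; [exact: domain1|]|reflexivity].
by rewrite mule_ge0 ?lee_fin ?invr_ge0// integral_ge0// => t _; rewrite lee_fin.
Qed.

Lemma Ces_norm_ge0 f : 0 <= Ces_norm f.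
Proof.
apply: fine_ge0; apply: le_trans (ereal_sup_ubound _); last first.
  by exists 1; [split; [exact: domain1|]|reflexivity].
by rewrite mule_ge0 ?lee_fin ?invr_ge0// integral_ge0// => t _; rewrite lee_fin.
Qed.

Lemma Ces_normD f g : Ces_norm (f + g) <= Ces_norm f + Ces_norm g.
Proof. by rewrite -lee_fin EFinD !Ces_normE; exact: cesaro_normD. Qed.

Lemma Ces_norm0_eq0 f : Ces_norm f = 0 -> f = 0.
Proof.
move=> nf0; have f0 : cesaro_norm f = 0%E by rewrite -Ces_normE nf0.
have ae0 (x : R) : x \in I -> 0 < x ->
    \forall t \ae mu, t \in `[0, x] -> (f : L0 mu) t = 0.
  move=> xI x0.
  have f0x : (\int[mu]_(t in `[0%R, x]) `|((f : L0 mu) t)%:E| = 0)%E.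
    apply/eqP; rewrite eq_le integral_ge0// andbT.
    rewrite -(@lee_pmul2l _ x^-1%:E)// ?lte_fin ?invr_gt0// mule0 -f0.
    by apply: ereal_sup_ubound; exists x.
  have mf : measurable_fun (`[0, x] : set (lebesgueType R))
      (fun t => ((f : L0 mu) t)%:E).
    by apply: measurable_funTS; apply/measurable_EFinP; exact: L0_meas.
  have := iffLR (ae_eq_integral_abs mu (lebesgue_measurable_itv `[0, x]) mf) f0x.
  by apply: filterS => t h tx; have [] := h tx.
apply: val_inj; apply: L0_eq.
suff f0' : \forall t \ae mu, (f : L0 mu) t = 0.
  near=> t; rewrite (near f0' t)//; apply/esym.
  by near: t; exact: L0_zeroE.
have dI : cesaro_domain I := hI.
case: dI => IE.
  have f1 := ae0 1 domain1 ltr01.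
  near=> t; apply: (near f1 t) => //; rewrite -IE.
  by near: t; exact: lebesgue_on_ae.
have nI n : n.+1%:R \in I by rewrite IE in_itv/= ler0n.
have /ae_foralln fn n := ae0 n.+1%:R (nI n) (ltr0Sn _ n).
near=> t; have tI : t \in I by near: t; exact: lebesgue_on_ae.
apply: (near fn t _ (Num.truncn t)) => //.
by move: tI; rewrite IE !in_itv/= andbT => ->/=; rewrite ltW// truncnS_gt.
Unshelve. all: by end_near. Qed.

Lemma Ces_normZ (a : R) f : Ces_norm (a *: f) = `|a| * Ces_norm f.
Proof.
apply: EFin_inj; rewrite EFinM !Ces_normE.
have [a0|a0] := eqVneq a 0; last exact: cesaro_normZ.
apply/eqP; rewrite eq_le cesaro_normZ_le/= a0 normr0 mul0e.
by rewrite -(Ces_normE (0 *: f)) lee_fin Ces_norm_ge0.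
Qed.

HB.instance Definition _ :=
  Lmodule_isNormed.Build R Ces Ces_normD Ces_normZ Ces_norm0_eq0.

Definition Ces_le f g : Prop := L0_le f g.
Definition Ces_join f g : Ces :=
  MkCes hI (cesaro_join_closed (ces_valP f) (ces_valP g)).
Definition Ces_meet f g : Ces :=
  MkCes hI (cesaro_meet_closed (ces_valP f) (ces_valP g)).

Lemma Ces_le_refl f : Ces_le f f. Proof. exact: L0_le_refl. Qed.

Lemma Ces_le_anti f g : Ces_le f g -> Ces_le g f -> f = g.
Proof. by move=> fg gf; apply/val_inj/L0_le_anti. Qed.

Lemma Ces_le_trans g f h : Ces_le f g -> Ces_le g h -> Ces_le f h.
Proof. exact: L0_le_trans. Qed.

Lemma Ces_joinP f g h : Ces_le (Ces_join f g) h <-> Ces_le f h /\ Ces_le g h.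
Proof. exact: L0_joinP. Qed.

Lemma Ces_meetP f g h : Ces_le h (Ces_meet f g) <-> Ces_le h f /\ Ces_le h g.
Proof. exact: L0_meetP. Qed.

Lemma Ces_leD h f g : Ces_le f g -> Ces_le (f + h) (g + h).
Proof. exact: L0_leD. Qed.

Lemma Ces_leZ (a : R) f g : 0 <= a -> Ces_le f g -> Ces_le (a *: f) (a *: g).
Proof. exact: L0_leZ. Qed.

Lemma Ces_norm_mono f g :
  Ces_le (Ces_join f (- f)) (Ces_join g (- g)) -> `|f| <= `|g|.
Proof.
move=> fg; rewrite -lee_fin.
rewrite [leLHS](Ces_normE f) [leRHS](Ces_normE g); apply: cesaro_norm_le.
apply: filterS3 fg (L0_absE f) (L0_absE g) => t fg f1 g1.
by rewrite -f1 -g1.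
Qed.

Definition Ces_lattice : normedLattice R :=
  @NormedLattice R Ces Ces_le Ces_join Ces_meet Ces_le_refl Ces_le_anti
    Ces_le_trans Ces_joinP Ces_meetP Ces_leD Ces_leZ Ces_norm_mono.

End Ces.

(* Main.v *)
Require Import Defs.
From mathcomp Require Import all_boot all_order all_algebra reals.
From HB Require Import structures.
From mathcomp Require Import classical_sets functions.
From mathcomp Require Import ereal normedtype measure measurable_realfun.
From mathcomp Require Import lebesgue_measure lebesgue_integral.

(** The function [1] has Cesaro norm [1], and so does its restriction to any
    subset of [[0, 1]] whose upper density at [0+] is [1].  Hence it suffices to
    cut a neighbourhood of [0] into infinitely many disjoint measurable sets
    [A_0, A_1, ...], each of upper density [1] at [0+]: the map

      T u = \sum_n u_n 1_(A_n)

    is a lattice homomorphism since the [A_n] are disjoint, its norm is at most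
    [1] since [|T u| <= `|u|] pointwise, and the density of [A_n] gives
    [`|T u| >= |u_n|] for every [n].  An isometric lattice homomorphism reflects
    the order, because [u <= v] means [u \/ v = v].

    The sets are unions of the scales [1/N^2 < t <= 1/N] with [N = 2^(2^k)]:
    these scales are consecutive, and each of them fills the proportion
    [1 - 1/N] of the interval [[0, 1/N]].  The scale of index [k] is given to
    [A_n], where [n] is the exponent of [2] in [k], so that every [A_n] receives
    arbitrarily small scales; all the points outside [(0, 1/2]] are added to
    [A_0].  With [scale_class t] the index [n] of the set
    containing [t], one simply has [T u t = u (scale_class t)].  The lemmas that
    carry the proof are [scale_class_eq] (the density of the [A_n]),
    [cesaro_norm_le_bound] and [cesaro_norm_ge_itv] (the two norm estimates). *)

Set Implicit Arguments.
Unset Strict Implicit.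
Unset Printing Implicit Defensive.
Import Order.TTheory GRing.Theory Num.Theory.
Import numFieldNormedType.Exports.
Local Open Scope classical_set_scope.
Local Open Scope ring_scope.

(** For [k > 0], [trunc_log 2 (trunc_log 2 m) = k] exactly when
    [2^(2^k) <= m < 2^(2^k.+1)], so the two logarithms find the scale of [t];
    [logn 2] takes each value for arbitrarily large [k]. *)
Definition scale_class (R : realType) (t : R) : nat :=
  logn 2 (trunc_log 2 (trunc_log 2 (Num.truncn t^-1))).

(** Every class contains [1/N^2 < t <= 1/N] for arbitrarily large [N], because
    an exponent [k] of 2-adic valuation [n] can be as large as desired. *)
Lemma scale_class_eq (R : realType) (n m : nat) :
  exists2 N : nat, (m < N)%N &
    forall t : R, (N%:R ^+ 2)^-1 < t <= N%:R^-1 -> scale_class t = n.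
Proof.
pose k := (2 ^ n * m.*2.+1)%N.
have k0 : (0 < k)%N by rewrite muln_gt0 expn_gt0.
exists (2 ^ (2 ^ k))%N.
  have mk : (m <= k)%N.
    rewrite (@leq_trans m.*2.+1) ?leq_pmull ?expn_gt0//.
    by rewrite -addnn leqW// leq_addr.
  by rewrite (leq_ltn_trans mk)// (@ltn_trans (2 ^ k))// ltn_expl.
set N := (2 ^ (2 ^ k))%N => t /andP[Nt tN].
have N0 : (0 : R) < N%:R by rewrite ltr0n expn_gt0.
have t0 : 0 < t by rewrite (le_lt_trans _ Nt)// invr_ge0 exprn_ge0// ltW.
have tV0 : 0 <= t^-1 by rewrite invr_ge0 ltW.
have lo : (N <= Num.truncn t^-1)%N.
  by rewrite truncn_ge_nat// -[N%:R]invrK lef_pV2// posrE invr_gt0.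
have hi : (Num.truncn t^-1 < N ^ 2)%N.
  by rewrite truncn_lt_nat// natrX -[_ ^+ 2]invrK ltf_pV2// posrE invr_gt0 exprn_gt0.
set p := Num.truncn t^-1 in lo hi *.
have p0 : (0 < p)%N by rewrite (leq_trans _ lo)// expn_gt0.
have lp : trunc_log 2 (trunc_log 2 p) = k.
  apply: trunc_log_eq => //; rewrite trunc_log_max//=.
  rewrite -(ltn_exp2l _ _ (isT : 1 < 2)%N) (leq_ltn_trans (trunc_logP _ _))//.
  by rewrite (leq_trans hi)// -expnM -expnSr.
rewrite /scale_class -/p lp lognM ?expn_gt0// pfactorK// logn_coprime ?addn0//.
by rewrite prime_coprime// dvdn2 /= odd_double.
Qed.

Section lebesgue_on_interval.
Variables (R : realType) (I : interval R).
Local Notation mu := (lebesgue_on I).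

(** [scale_class] depends on [t] only through the integer [truncn t^-1], whose
    level sets are differences of intervals [`]0, 1/k]] or, at [0], the
    complement of one. *)
Lemma measurable_scale_class (u : nat -> R) :
  measurable_fun [set: lebesgueType R] (fun t : R => u (scale_class t)).
Proof.
pose q (t : R) := Num.truncn t^-1.
have mgt k : measurable ([set t | (k < q t)%N] : set (lebesgueType R)).
  rewrite (_ : mkset _ = [set` `]0, k.+1%:R^-1]]).
    exact: lebesgue_measurable_itv.
  apply/seteqP; split => t /=; rewrite in_itv/= /q truncn_gt_nat.
    move=> kt; have tV0 : 0 < t^-1 by apply: lt_le_trans kt.
    rewrite -invr_gt0 tV0 -[t]invrK lef_pV2// posrE//.
  by move=> /andP[t0 tk]; rewrite -[leLHS]invrK lef_pV2// posrE invr_gt0.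
have meq k : measurable ([set t | q t = k] : set (lebesgueType R)).
  case: k => [|k].
    rewrite (_ : mkset _ = ~` [set t | (0 < q t)%N]); first exact: measurableC.
    by apply/seteqP; split => t /=; rewrite lt0n; [move->|move/negP/negPn/eqP].
  rewrite (_ : mkset _ = [set t | (k < q t)%N] `\` [set t | (k.+1 < q t)%N]).
    exact: measurableD.
  apply/seteqP; split => t /=; first by move=> ->; rewrite !ltnn.
  by move=> [kq /negP]; rewrite -leqNgt => qk; apply/eqP; rewrite eqn_leq qk.
move=> _ Y _; rewrite setTI.
pose v m := u (logn 2 (trunc_log 2 (trunc_log 2 m))).
rewrite (_ : _ @^-1` Y = \bigcup_(m in v @^-1` Y) [set t | q t = m]).
  by apply: bigcup_measurable => m _.
by apply/seteqP; split => t /= => [Yt|[m Ym qm]]; [exists (q t)|rewrite -qm in Ym].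
Qed.

(** Both measures are restrictions of the same outer measure, which makes the
    values on intervals available for the completed one. *)
Lemma completed_lebesgue_measureE (A : set R) :
  completed_lebesgue_measure A = lebesgue_measure A.
Proof. by []. Qed.

Lemma lebesgue_on_le_itv (x : R) : 0 <= x ->
  (mu [set` `[0%R, x]] <= x%:E)%E.
Proof.
move=> x0; rewrite /lebesgue_on /= /mrestr.
apply: (@le_trans _ _ (completed_lebesgue_measure [set` `[0, x]])).
  apply: le_measure; rewrite ?inE; last exact: subIsetl.
    by apply: measurableI; exact: lebesgue_measurable_itv.
  exact: lebesgue_measurable_itv.
rewrite completed_lebesgue_measureE lebesgue_measure_itv/= lte_fin.
by case: ifP; rewrite lee_fin ?subr0.
Qed.

Lemma lebesgue_on_itv (a b : R) : a <= b -> [set` `]a, b]] `<=` [set` I] ->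
  mu [set` `]a, b]] = (b - a)%:E.
Proof.
move=> ab abI; rewrite /lebesgue_on /= /mrestr setIidl//.
rewrite completed_lebesgue_measureE lebesgue_measure_itv/= lte_fin.
case: ifPn => [_|]; first by rewrite EFinB.
by rewrite -leNgt => ba; rewrite (@le_anti _ _ a b) ?ab// subrr.
Qed.

Local Open Scope ereal_scope.

Let mabs (D : set (lebesgueType R)) (f : L0 mu) :
  measurable_fun D (fun t => `|f t|%:E).
Proof.
apply: measurable_funTS; apply/measurable_EFinP.
by apply: measurableT_comp => //; exact: L0_meas.
Qed.

(** The mean of [`|f|] over [[0, x]] cannot exceed an almost sure bound; that
    [mu] ignores the part of [[0, x]] outside [I] only lowers the mean. *)
Lemma cesaro_norm_le_bound (f : L0 mu) (M : R) : (0 <= M)%R ->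
  (\forall t \ae mu, `|f t| <= M)%R -> cesaro_norm f <= M%:E.
Proof.
move=> M0 fM; apply: ge_ereal_sup => _ [x /= [xI x0] <-].
rewrite lee_pdivrMl//.
apply: (@le_trans _ _ (\int[mu]_(t in `[0%R, x]) (cst M%:E t))).
  apply: ae_ge0_le_integral => //; first exact: lebesgue_measurable_itv.
  by apply: filterS fM => t tM _; rewrite lee_fin.
rewrite integral_cst; last exact: lebesgue_measurable_itv.
by rewrite muleC lee_wpmul2r ?lee_fin// lebesgue_on_le_itv// ltW.
Qed.

(** Take the mean over [[0, b]]: the part [`]a, b]] alone contributes
    [`|c| * (b - a)] to the integral. *)
Lemma cesaro_norm_ge_itv (f : L0 mu) (a b c : R) :
 (0 <= a < b)%R -> [set` `]a, b]] `<=` [set` I] ->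
  (\forall t \ae mu, t \in `]a, b] -> f t = c)%R ->
  (`|c| * (1 - a / b))%:E <= cesaro_norm f.
Proof.
move=> /andP[a0 ab] abI fc; have b0 : (0 < b)%R := le_lt_trans a0 ab.
apply: le_trans (ereal_sup_ubound _); last first.
  exists b; [split=> //|reflexivity].
  by apply: abI; rewrite /= in_itv/= ab lexx.
rewrite lee_pdivlMl//.
apply: (@le_trans _ _ (\int[mu]_(t in `]a, b]) `|f t|%:E)); last first.
  apply: ge0_subset_integral => //; try exact: lebesgue_measurable_itv.
  move=> t /=; rewrite !in_itv/= => /andP[/ltW at_ ->].
  by rewrite (le_trans a0).
apply: (@le_trans _ _ (\int[mu]_(t in `]a, b]) (cst `|c|%:E t))).
  rewrite integral_cst; last exact: lebesgue_measurable_itv.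
  rewrite lebesgue_on_itv ?(ltW ab)// -!EFinM lee_fin mulrCA ler_wpM2l//.
  by rewrite mulrBr mulr1 mulrCA divff ?mulr1// gt_eqF.
apply: ae_ge0_le_integral => //; first exact: lebesgue_measurable_itv.
  by move=> t _; rewrite lee_fin.
by near=> t => tab; rewrite (near fc t).
Unshelve. all: by end_near. Qed.

End lebesgue_on_interval.

Section embedding.
Variables (R : realType) (I : interval R) (hI : cesaro_domain I).
Local Notation mu := (lebesgue_on I).

Definition linf_step (u : linf R) : L0 mu := L0_of mu (measurable_scale_class u).

Lemma linf_stepE (u : linf R) :
  \forall t \ae mu, linf_step u t = u (scale_class t).
Proof. exact: L0_ofE. Qed.

Lemma cesaro_norm_linf_step_le (u : linf R) :
  (cesaro_norm (linf_step u) <= (linf_norm u)%:E)%E.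
Proof.
apply: cesaro_norm_le_bound; first by rewrite (le_trans _ (linf_norm_ub u 0)).
by apply: filterS (linf_stepE u) => t ->; exact: linf_norm_ub.
Qed.

Lemma linf_step_in_cesaro (u : linf R) : linf_step u \in @cesaro_pred R I.
Proof.
by rewrite cesaro_predE (le_lt_trans (cesaro_norm_linf_step_le u))// ltry.
Qed.

Definition linf_embedding (u : linf R) : Ces hI :=
  MkCes hI (linf_step_in_cesaro u).

Lemma linf_embedding_linear : linear linf_embedding.
Proof.
move=> a u v; apply/val_inj/L0_eq => /=; near=> t.
rewrite (near (linf_stepE _) t)//.
rewrite (near (L0_addE (a *: linf_step u) (linf_step v)) t)//.
rewrite (near (L0_scaleE a (linf_step u)) t)//.
by rewrite (near (linf_stepE u) t)// (near (linf_stepE v) t).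
Unshelve. all: by end_near. Qed.

HB.instance Definition _ :=
  GRing.isLinear.Build R (linf R) (Ces hI) *:%R linf_embedding
    linf_embedding_linear.

(** The upper bound is pointwise.  For the lower one, a scale
    [1/N^2 < t <= 1/N] of class [n] forces the norm to be at least
    [`|u n| * (1 - 1/N)], and [N] is as large as desired. *)
Lemma linf_embedding_norm (u : linf R) : `|linf_embedding u| = `|u|.
Proof.
have normE : `|linf_embedding u|%:E = cesaro_norm (linf_step u).
  exact: (Ces_normE (linf_embedding u)).
apply/eqP; rewrite eq_le; apply/andP; split.
  by rewrite -lee_fin normE cesaro_norm_linf_step_le.
apply: linf_norm_le => n; apply/ler_addgt0Pr => e e0.
(* [N] exceeds [|u n| / e], so that the defect [|u n| / N] is at most [e]. *)
have [N mN NE] := scale_class_eq R n (Num.truncn (`|u n| / e)).+1.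
have N1 : (1 : R) < N%:R by rewrite ltr1n (leq_trans _ mN).
have N0 : (0 : R) < N%:R := lt_trans ltr01 N1.
have : ((`|u n| * (1 - (N%:R ^+ 2)^-1 / N%:R^-1))%:E <=
        cesaro_norm (linf_step u))%E.
  apply: cesaro_norm_ge_itv.
  - by rewrite invr_ge0 exprn_ge0 ?(ltW N0)//= ltf_pV2 ?posrE ?exprn_gt0// ltr_eXnr.
  - move=> t /=; rewrite in_itv/= => /andP[/ltW Nt tN].
    have t0 : 0 <= t by rewrite (le_trans _ Nt)// invr_ge0 exprn_ge0// ltW.
    have t1 : t <= 1 by rewrite (le_trans tN)// invf_le1// ltW.
    by case: hI => ->; rewrite in_itv/= t0.
  - by apply: filterS (linf_stepE u) => t -> tN; rewrite NE// -in_itv.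
rewrite -normE lee_fin invrK expr2 invfM -mulrA mulVf ?gt_eqF// mulr1.
rewrite mulrBr mulr1 lerBlDr => /le_trans; apply; rewrite lerD2l.
rewrite ler_pdivrMr// mulrC -ler_pdivrMr//.
by rewrite (le_trans (ltW (truncnS_gt _)))// ler_nat ltnW.
Qed.

Lemma linf_embedding_join (u v : linf R) :
  linf_embedding (linf_join u v) = Ces_join (linf_embedding u) (linf_embedding v).
Proof.
apply/val_inj/L0_eq => /=; near=> t; rewrite (near (linf_stepE _) t)//.
rewrite (near (L0_joinE (linf_step u) (linf_step v)) t)//.
by rewrite (near (linf_stepE u) t)// (near (linf_stepE v) t).
Unshelve. all: by end_near. Qed.

Lemma linf_embedding_meet (u v : linf R) :
  linf_embedding (linf_meet u v) = Ces_meet (linf_embedding u) (linf_embedding v).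
Proof.
apply/val_inj/L0_eq => /=; near=> t; rewrite (near (linf_stepE _) t)//.
rewrite (near (L0_meetE (linf_step u) (linf_step v)) t)//.
by rewrite (near (linf_stepE u) t)// (near (linf_stepE v) t).
Unshelve. all: by end_near. Qed.

End embedding.

Lemma nl_le_joinE (R : realType) (E : normedLattice R) (x y : E) :
  nl_le x y <-> nl_join x y = y.
Proof.
have ub : nl_le x (nl_join x y) /\ nl_le y (nl_join x y).
  exact/nl_joinP/nl_le_refl.
split=> [xy|<-]; last by case: ub.
apply: nl_le_anti; last by case: ub.
by apply/nl_joinP; split => //; exact: nl_le_refl.
Qed.

(** Injectivity transports the equation [x \/ y = y] back from the image. *)
Lemma isometric_join_morphism_le (R : realType) (F E : normedLattice R)
    (T : {linear F -> E}) :
  (forall x, `|T x| = `|x|) ->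
  (forall x y, T (nl_join x y) = nl_join (T x) (T y)) ->
  forall x y, nl_le (T x) (T y) <-> nl_le x y.
Proof.
move=> Tnorm Tjoin x y; rewrite !nl_le_joinE -Tjoin; split => [Txy|-> //].
apply/eqP; rewrite -subr_eq0 -normr_eq0 -Tnorm linearB Txy subrr.
by rewrite normr0.
Qed.

Theorem proposition4p9 (R : realType) (I : interval R) (hI : cesaro_domain I) :
  contains_order_isometric_copy (linf_lattice R) (Ces_lattice hI).
Proof.
pose T : {linear linf_lattice R -> Ces_lattice hI} := linf_embedding hI.
exists T; have Tnorm := linf_embedding_norm hI.
have Tjoin := linf_embedding_join hI.
split => //; last exact: linf_embedding_meet.
exact: (isometric_join_morphism_le (T := T)).
Qed.
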